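(* Let $E$ be an ellipse in 3-dimensional Euclidean space, lying in a plane $\Pi$, with (distinct) foci $F_1$ and $F_2$ and with major axis the segment $\overline{AP}$. Let $\Pi'$ be the unique plane containing the line $F_1F_2$ and perpendicular to $\Pi$. Then the vertices of cones belonging to $E$ lie on the hyperbola in $\Pi'$ having foci $A$ and $P$ and vertices $F_1$ and $F_2$.
   Context: A cone means a right circular (double) cone: given a line (the axis) and a point $V$ on it (the vertex), the cone is the locus of points $Q$ (together with $V$) such that the smaller positive angle between the line $QV$ and the axis has a fixed value in $(0,\pi/2)$. An ellipse with foci $F_1\neq F_2$ is the locus of points in a plane the sum of whose distances from $F_1$ and $F_2$ is a given constant (larger than $|F_1F_2|$). A cone $C$ is said to belong to the ellipse $E\subset\Pi$ if $E=C\cap\Pi$. The points $A$ and $P$ are the two endpoints of the major axis of $E$. *)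

(* Defs.v *)
From mathcomp Require Import all_boot all_order all_algebra.
From mathcomp Require Import all_classical all_reals all_analysis.

Set Implicit Arguments.
Unset Strict Implicit.
Unset Printing Implicit Defensive.

Import Order.TTheory GRing.Theory Num.Theory.

Local Open Scope classical_set_scope.
Local Open Scope ring_scope.

Section Euclidean.
Variable R : realType.
Implicit Types (u v d n p X V A P F : 'rV[R]_3) (S C E H L Pi : set 'rV[R]_3).

Definition dotv u v : R := \sum_(i < 3) u 0 i * v 0 i.

(* The library's norm `|u| on 'rV[R]_3 is the sup norm, hence this one. *)
Definition enorm u : R := Num.sqrt (dotv u u).

Definition edist X Y : R := enorm (X - Y).

Definition line_dir p d : set 'rV[R]_3 := [set p + t *: d | t in [set: R]].

(* A line only when A != P. *)
Definition line_through A P : set 'rV[R]_3 := line_dir A (P - A).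

(* A plane only when n != 0. *)
Definition plane_normal p n : set 'rV[R]_3 := [set X | dotv n (X - p) = 0].

Definition is_plane Pi : Prop :=
  exists p n, n != 0 /\ Pi = plane_normal p n.

Definition perpendicular_planes Pi Pi' : Prop :=
  exists p n p' n',
    [/\ n != 0, n' != 0, Pi = plane_normal p n, Pi' = plane_normal p' n'
      & dotv n n' = 0].

Definition vangle u v : R := acos (dotv u v / (enorm u * enorm v)).

(* Two lines with directions u and v form the angles a and pi - a,
   where a = vangle u v; this is the smaller one. *)
Definition line_angle u v : R := Num.min (vangle u v) (pi - vangle u v).

(* Right circular double cone with vertex V, axis line_dir V d and
   half-aperture theta. *)
Definition cone V d (theta : R) : set 'rV[R]_3 :=
  [set Q | Q = V \/ (Q <> V /\ line_angle (Q - V) d = theta)].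

Definition is_cone_with_vertex C V : Prop :=
  exists d theta, [/\ d != 0, 0 < theta < pi / 2 & C = cone V d theta].

Definition is_ellipse E Pi F1 F2 : Prop :=
  [/\ is_plane Pi, Pi F1, Pi F2, F1 <> F2 &
      exists s : R, edist F1 F2 < s /\
        E = [set Q | Pi Q /\ edist Q F1 + edist Q F2 = s]].

(* The major axis is the chord of the ellipse cut out by the line of foci. *)
Definition major_axis_ends E F1 F2 A P : Prop :=
  A <> P /\ E `&` line_through F1 F2 = [set A; P].

Definition belongs_to_ellipse C E Pi : Prop := E = C `&` Pi.

(* Hyperbola in the plane Pi with foci A, P and vertices F1, F2, its vertices
   being its points on the line of foci. *)
Definition is_hyperbola H Pi A P F1 F2 : Prop :=
  [/\ is_plane Pi, Pi A, Pi P,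
      exists c : R, 0 < c < edist A P /\
        H = [set Q | Pi Q /\ `|edist Q A - edist Q P| = c]
    & F1 <> F2 /\ H `&` line_through A P = [set F1; F2]].

End Euclidean.

(* Main.v *)
(* Put the origin at the centre of the ellipse, with orthonormal axes along F1F2,
   along the minor axis, and normal to Pi, and let b^2 = a^2 - c^2. Squaring the
   angle condition, a cone with vertex V = (u, v, w) and axis direction d satisfies
   (d.(X - V))^2 = k |X - V|^2; in the plane of the ellipse this must be a
   multiple of x^2/a^2 + y^2/b^2 = 1. Comparing coefficients forces d to be
   orthogonal to the minor axis, v = 0 and u^2/c^2 - w^2/b^2 = 1. On that curve
   the distances from V to the foci (a, 0, 0) and (-a, 0, 0) are |au/c - c| and
   |au/c + c|, whose difference is 2c in absolute value. *)

Require Import Defs.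
From mathcomp Require Import all_boot all_order all_algebra.
From mathcomp Require Import all_classical all_reals all_analysis.
From mathcomp Require Import ring lra.

Set Implicit Arguments.
Unset Strict Implicit.
Unset Printing Implicit Defensive.

Import Order.TTheory GRing.Theory Num.Theory.

Local Open Scope classical_set_scope.
Local Open Scope ring_scope.

(* Without the prefix, [edist] is the extended distance of MathComp-Analysis. *)
Local Notation edist := Defs.edist.

(** * Euclidean inner product, orthonormal expansions and the quadratic equation of a cone *)

Section DotProduct.
Variable R : realType.
Implicit Types u v w : 'rV[R]_3.

Lemma dotvC u v : dotv u v = dotv v u.
Proof. by apply: eq_bigr => i _; rewrite mulrC. Qed.

Lemma dotvDl u v w : dotv (u + v) w = dotv u w + dotv v w.
Proof. by rewrite -big_split; apply: eq_bigr => i _; rewrite mxE mulrDl. Qed.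

Lemma dotvZl (t : R) u v : dotv (t *: u) v = t * dotv u v.
Proof. by rewrite mulr_sumr; apply: eq_bigr => i _; rewrite mxE mulrA. Qed.

Lemma dotvBl u v w : dotv (u - v) w = dotv u w - dotv v w.
Proof. by rewrite -(scaleN1r v) dotvDl dotvZl mulN1r. Qed.

Lemma dotvDr u v w : dotv w (u + v) = dotv w u + dotv w v.
Proof. by rewrite ![dotv w _]dotvC dotvDl. Qed.

Lemma dotvZr (t : R) u v : dotv u (t *: v) = t * dotv u v.
Proof. by rewrite ![dotv u _]dotvC dotvZl. Qed.

Lemma dotvBr u v w : dotv w (u - v) = dotv w u - dotv w v.
Proof. by rewrite ![dotv w _]dotvC dotvBl. Qed.

Lemma dotv_ge0 u : 0 <= dotv u u.
Proof. by apply: sumr_ge0 => i _; rewrite -expr2 sqr_ge0. Qed.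

Lemma dotv_eq0 u : (dotv u u == 0) = (u == 0).
Proof.
apply/idP/eqP => [|->]; last by rewrite -(scale0r 0) dotvZl mul0r.
rewrite psumr_eq0 => [/allP u0|i _]; last by rewrite -expr2 sqr_ge0.
apply/rowP => i; rewrite mxE; apply/eqP.
by have := u0 i (mem_index_enum _); rewrite mulf_eq0 orbb.
Qed.

Lemma dotv_gt0 u : (0 < dotv u u) = (u != 0).
Proof. by rewrite lt_def dotv_ge0 dotv_eq0 andbT. Qed.

Lemma enorm_sqr u : enorm u ^+ 2 = dotv u u.
Proof. by rewrite sqr_sqrtr ?dotv_ge0. Qed.

Lemma enorm_gt0 u : (0 < enorm u) = (u != 0).
Proof. by rewrite sqrtr_gt0 dotv_gt0. Qed.

Lemma dotv_normalize u : u != 0 ->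
  dotv ((enorm u)^-1 *: u) ((enorm u)^-1 *: u) = 1.
Proof.
rewrite -enorm_gt0 => u0; rewrite dotvZl dotvZr -enorm_sqr; field.
by rewrite gt_eqF.
Qed.

Lemma dotv_cauchy_schwarz u v : dotv u v ^+ 2 <= dotv u u * dotv v v.
Proof.
(* Lagrange's identity *)
rewrite /dotv !big_ord_recl !big_ord0 -subr_ge0.
set a := u 0 _; set b := u 0 _; set c := u 0 _.
set x := v 0 _; set y := v 0 _; set z := v 0 _.
have -> : (a * a + (b * b + (c * c + 0))) * (x * x + (y * y + (z * z + 0))) -
    (a * x + (b * y + (c * z + 0))) ^+ 2 =
    (a * y - b * x) ^+ 2 + (a * z - c * x) ^+ 2 + (b * z - c * y) ^+ 2 by ring.
by rewrite !addr_ge0 ?sqr_ge0.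
Qed.

(** The matrix [M] with rows [e i] satisfies M M^T = 1. Being square, it also satisfies M^T M = 1,
    and this product is inserted between u and v^T. *)
Lemma dotv_parseval (e : 'I_3 -> 'rV[R]_3) :
  (forall i j, dotv (e i) (e j) = (i == j)%:R) ->
  forall u v, dotv u v = \sum_i dotv u (e i) * dotv v (e i).
Proof.
move=> e_on u v.
have dotE x y : dotv x y = (x *m y^T) 0 0.
  by rewrite mxE; apply: eq_bigr => i _; rewrite mxE.
pose M : 'M[R]_3 := \matrix_(i, j) e i 0 j.
have MV : M^T *m M = 1%:M.
  apply: mulmx1C; apply/matrixP => i j; rewrite !mxE -e_on.
  by apply: eq_bigr => k _; rewrite !mxE.
have coordE x i : (x *m M^T) 0 i = dotv x (e i).
  by rewrite mxE; apply: eq_bigr => j _; rewrite !mxE.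
rewrite dotE -[u in LHS]mulmx1 -MV mulmxA -mulmxA mxE.
apply: eq_bigr => i _; rewrite coordE; congr (_ * _).
by rewrite mxE; apply: eq_bigr => j _; rewrite !mxE mulrC.
Qed.

Lemma dotv_parseval3 (e1 e2 e3 : 'rV[R]_3) :
  dotv e1 e1 = 1 -> dotv e2 e2 = 1 -> dotv e3 e3 = 1 ->
  dotv e1 e2 = 0 -> dotv e1 e3 = 0 -> dotv e2 e3 = 0 ->
  forall u v, dotv u v =
    dotv u e1 * dotv v e1 + dotv u e2 * dotv v e2 + dotv u e3 * dotv v e3.
Proof.
move=> e11 e22 e33 e12 e13 e23 u v.
rewrite (@dotv_parseval (fun i => [:: e1; e2; e3]`_i)).
  by rewrite !big_ord_recl big_ord0 addr0 addrA.
by move=> [[|[|[|//]]] ?] [[|[|[|//]]] ?] //=; rewrite dotvC.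
Qed.

(** Squaring absorbs the choice between an angle and its supplement, whose cosines are opposite. At
    the vertex both sides vanish. *)
Lemma cone_quadratic (V d Q : 'rV[R]_3) (theta : R) :
  d != 0 -> 0 < theta < pi / 2 -> cone V d theta Q ->
  dotv (Q - V) d ^+ 2 =
  cos theta ^+ 2 * dotv d d * dotv (Q - V) (Q - V).
Proof.
move=> d0 theta_bd [->|[/eqP QV]].
  by rewrite subrr -(scale0r 0) !dotvZl; ring.
rewrite -subr_eq0 in QV; set u := Q - V in QV *.
have nz : enorm u * enorm d != 0 by rewrite mulf_neq0 // gt_eqF ?enorm_gt0.
set t := dotv u d / (enorm u * enorm d) => angleE.
have tE : dotv u d = t * (enorm u * enorm d) by rewrite /t divfK.
(* Cauchy-Schwarz puts [t] in the range where [cos] inverts [acos]. *)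
have t1 : -1 <= t <= 1.
  rewrite -ler_norml -(@ler_pXn2r _ 2) ?nnegrE // expr1n real_normK ?num_real //.
  rewrite /t expr_div_n ler_pdivrMr ?exprn_even_gt0 // mul1r exprMn !enorm_sqr.
  exact: dotv_cauchy_schwarz.
have -> : cos theta ^+ 2 = t ^+ 2.
  rewrite -angleE /line_angle /vangle -/t minEle; case: ifP => _.
    by rewrite acosK.
  by rewrite addrC cosDpi cosN acosK // sqrrN.
by rewrite tE !exprMn !enorm_sqr; ring.
Qed.

End DotProduct.

(** * Real-number identities and the comparison of coefficients *)

Section Scalar.
Variable R : realType.
Implicit Types a b c t u v w x y z : R.

(** Serves twice: for a point of the axis against two foci symmetric about the centre, and for a
    cone vertex, whose focal distances also take the form |t - c| and |t + c|. *)
Lemma dist_pm t c : `| `|t - c| - `|t + c| | = 2 * Num.min `|t| `|c|.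
Proof.
rewrite minEle; case: ifP; case: (ger0P t); case: (ger0P c);
case: (ger0P (t - c)); case: (ger0P (t + c)) => *;
match goal with |- `| ?x | = _ => case: (ger0P x) end; lra.
Qed.

(* The difference of the two sides of the cone equation is a quadratic polynomial
   in x, y. Its vanishing at the four vertices of the ellipse and at
   (3a/5, 4b/5) already makes it a multiple of x^2/a^2 + y^2/b^2 - 1. *)
Lemma cone_vertex_coords a b c k al be m u v w :
  0 < c -> 0 < a -> 0 < b -> b ^+ 2 = a ^+ 2 - c ^+ 2 -> 0 < k ->
  (forall x y, x ^+ 2 * b ^+ 2 + y ^+ 2 * a ^+ 2 = a ^+ 2 * b ^+ 2 ->
    (al * x + be * y - m) ^+ 2 =
    k * ((x - u) ^+ 2 + (y - v) ^+ 2 + w ^+ 2)) ->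
  v = 0 /\ u ^+ 2 * b ^+ 2 = c ^+ 2 * (w ^+ 2 + b ^+ 2).
Proof.
move=> c0 a0 b0 bE k0 q.
have q1 := q a 0 ltac:(ring).
have q2 := q (- a) 0 ltac:(ring).
have q3 := q 0 b ltac:(ring).
have q4 := q 0 (- b) ltac:(ring).
have q5 := q (3 / 5 * a) (4 / 5 * b) ltac:(field).
(* [cij] compares coefficients of x^i y^j: differences of the equations at opposite vertices give
   the linear ones, sums the pure squares, and the fifth point the mixed one. *)
have c10 : al * m = k * u.
  apply: (mulfI (lt0r_neq0 a0)); move: q1 q2; clear => q1 q2 /=.
  lra.
have c01 : be * m = k * v by apply: (mulfI (lt0r_neq0 b0)) => /=; clear q; lra.
have c20 : (al ^+ 2 - k) * a ^+ 2 = k * (u ^+ 2 + v ^+ 2 + w ^+ 2) - m ^+ 2.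
  lra.
have c02 : (be ^+ 2 - k) * b ^+ 2 = k * (u ^+ 2 + v ^+ 2 + w ^+ 2) - m ^+ 2.
  lra.
have c11 : al * be = 0.
  apply: (mulfI (lt0r_neq0 a0)); apply: (mulfI (lt0r_neq0 b0)).
  have := congr1 ( *%R a) c10; have := congr1 ( *%R b) c01.
  by move: c20 c02 q5; clear; lra.
have be0 : be = 0.
  move/eqP: c11; rewrite mulf_eq0 => /orP[/eqP al0|/eqP //].
  (* With al = 0, a square would equal a negative number, because b < a. *)
  have : (be * b) ^+ 2 = - (k * c ^+ 2).
    by move: c20 c02; rewrite al0 exprMn bE; lra.
  have := sqr_ge0 (be * b).
  have : 0 < k * c ^+ 2 by rewrite mulr_gt0 ?exprn_gt0.
  lra.
have v0 : v = 0.
  by apply: (mulfI (lt0r_neq0 k0)); rewrite -c01 be0; ring.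
split=> //.
have alE : al ^+ 2 * a ^+ 2 = k * c ^+ 2.
  by move: c20 c02; rewrite be0 bE; lra.
have mE : m ^+ 2 = k * (u ^+ 2 + w ^+ 2 + b ^+ 2).
  by move: c02; rewrite be0 v0; lra.
apply: (mulfI (lt0r_neq0 (exprn_gt0 2 k0))).
(* Squaring al m = k u allows [al] and [m] to be eliminated; the terms in c^2 u^2 then cancel since
   a^2 = b^2 + c^2. *)
have e : (al ^+ 2 * a ^+ 2) * m ^+ 2 = a ^+ 2 * (k * u) ^+ 2.
  by rewrite -c10; ring.
move: e; rewrite alE mE => e.
have aE : a ^+ 2 = b ^+ 2 + c ^+ 2 by rewrite bE; ring.
by move: e; rewrite aE; lra.
Qed.

End Scalar.

(** * Ellipse and hyperbola in coordinates centred at [O] *)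

Section Frame.
Variable R : realType.
Implicit Types (a c x y t : R) (O e X Y A P : 'rV[R]_3) (Pi : set 'rV[R]_3).

Lemma subr_shift O X Y : O + X - (O + Y) = X - Y.
Proof. by rewrite opprD addrACA subrr add0r. Qed.

Lemma edist_sqrt X Y t : dotv (X - Y) (X - Y) = t ^+ 2 -> edist X Y = `|t|.
Proof. by rewrite /edist /enorm => ->; rewrite sqrtr_sqr. Qed.

Lemma edist_line O e x y : dotv e e = 1 ->
  edist (O + x *: e) (O + y *: e) = `|x - y|.
Proof.
move=> e1; apply: edist_sqrt.
by rewrite subr_shift -scalerBl dotvZl dotvZr e1; ring.
Qed.

Lemma line_through_on_axis O e x y : x != y ->
  line_through (O + x *: e) (O + y *: e) = line_dir O e.
Proof.
rewrite eq_sym -subr_eq0 => xy; rewrite /line_through subr_shift -scalerBl.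
apply/seteqP; split => _ [t _ <-].
  by exists (x + t * (y - x)) => //; rewrite scalerA scalerDl addrA.
exists ((t - x) / (y - x)) => //.
by rewrite scalerA divfK // scalerBl addrA addrAC addrK.
Qed.

Lemma line_in_plane p n O e :
  plane_normal p n O -> dotv n e = 0 -> line_dir O e `<=` plane_normal p n.
Proof.
move=> pO ne _ [t _ <-]; rewrite /plane_normal /=.
by rewrite addrAC dotvDr dotvZr ne mulr0 addr0.
Qed.

(** At abscissa x on the axis the difference of distances is 2 min(|x|, |a|), which equals 2c
    exactly when x = c or x = -c, as c < |a|. The sign of [a] is left free because either end of the
    major axis may be called A. *)
Lemma hyperbola_on_axis Pi O e a c : dotv e e = 1 -> 0 < c < `|a| ->
  is_plane Pi -> line_dir O e `<=` Pi ->
  is_hyperbola [set Q | Pi Q /\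
      `|edist Q (O + a *: e) - edist Q (O + (- a) *: e)| = 2 * c]
    Pi (O + a *: e) (O + (- a) *: e) (O + (- c) *: e) (O + c *: e).
Proof.
move=> e1 /andP[c0 ca] hPi linePi.
have onPi x : Pi (O + x *: e) by apply: linePi; exists x.
have a0 : a != - a.
  apply/eqP => aN; have a0 : a = 0 by lra.
  by move: ca; rewrite a0 normr0; lra.
have sumE x : `|edist (O + x *: e) (O + a *: e) -
    edist (O + x *: e) (O + (- a) *: e)| = 2 * Num.min `|x| `|a|.
  by rewrite !edist_line // opprK dist_pm.
split => //.
  exists (2 * c); split => //.
  rewrite edist_line // opprK -mulr2n normrMn.
  by apply/andP; split; lra.
split.
  move=> /addrI/eqP; rewrite -subr_eq0 -scalerBl scaler_eq0.
  have -> : (e == 0) = false.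
    by apply/negbTE; rewrite -dotv_gt0 e1.
  by rewrite orbF => /eqP; lra.
rewrite line_through_on_axis //; apply/seteqP; split => Q /=.
  move=> [[_ +] [x _ xQ]]; rewrite -xQ sumE => /mulfI.
  rewrite pnatr_eq0 => /(_ isT); rewrite minEle.
  case: ifP => _ cE; last by move: ca; rewrite cE ltxx.
  by case: (ger0P x) cE => _ <-; [right|left; rewrite opprK].
have on_hyp x : `|x| = c -> Q = O + x *: e ->
    (Pi Q /\ `|edist Q (O + a *: e) - edist Q (O + (- a) *: e)| = 2 * c) /\
    line_dir O e Q.
  move=> xc ->; split; last by exists x.
  by split=> //; rewrite sumE xc min_l // ltW.
by move=> []; apply: on_hyp; rewrite ?normrN gtr0_norm.
Qed.

(** The focal radii are a + cx/a and a - cx/a, both nonnegative because |x| <= a and c < a. *)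
Lemma ellipse_point O e1 e2 a c x y : dotv e1 e1 = 1 -> dotv e2 e2 = 1 ->
  dotv e1 e2 = 0 -> 0 < c < a ->
  x ^+ 2 * (a ^+ 2 - c ^+ 2) + y ^+ 2 * a ^+ 2 = a ^+ 2 * (a ^+ 2 - c ^+ 2) ->
  edist (O + (x *: e1 + y *: e2)) (O + (- c) *: e1) +
  edist (O + (x *: e1 + y *: e2)) (O + c *: e1) = 2 * a.
Proof.
move=> e11 e22 e12 /andP[c0 ca] xy.
have a0 : 0 < a by lra.
have sqD t : t ^+ 2 = c ^+ 2 ->
    edist (O + (x *: e1 + y *: e2)) (O + t *: e1) = `|a - t * x / a|.
  move=> tc; apply: edist_sqrt; rewrite subr_shift addrAC -scalerBl.
  rewrite !(dotvDl, dotvDr, dotvZl, dotvZr) [dotv e2 e1]dotvC e11 e22 e12.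
  have yE : y ^+ 2 = (a ^+ 2 - x ^+ 2) * (a ^+ 2 - t ^+ 2) / a ^+ 2.
    apply: (mulIf (lt0r_neq0 (exprn_gt0 2 a0))).
    by rewrite divfK ?lt0r_neq0 ?exprn_gt0 // tc; move: xy; lra.
  transitivity ((x - t) ^+ 2 + y ^+ 2); first ring.
  by rewrite yE; field; rewrite lt0r_neq0.
rewrite !sqD ?sqrrN //.
have xa : `|c * x / a| <= a.
  have x_le : `|x| <= a.
    rewrite -(@ler_pXn2r _ 2) ?nnegrE ?(ltW a0) // real_normK ?num_real //.
    have b0 : 0 < a ^+ 2 - c ^+ 2.
      by rewrite subr_gt0 ltr_pXn2r // nnegrE ltW.
    rewrite -(ler_pM2r b0).
    have : 0 <= y ^+ 2 * a ^+ 2 by rewrite mulr_ge0 ?sqr_ge0.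
    lra.
  rewrite !normrM normfV (gtr0_norm c0) (gtr0_norm a0) ler_pdivrMr //.
  by apply: ler_pM => //; exact: ltW.
rewrite !mulNr opprK.
move: xa; rewrite ler_norml => /andP[xa1 xa2].
by rewrite !ger0_norm; lra.
Qed.

(** The points at abscissas a and -a are distinct and lie in the pair {A, P}, so they exhaust it;
    the sign of [t] records which one is A. *)
Lemma major_axis_on_axis Pi O e a c A P : dotv e e = 1 -> 0 < c < a ->
  line_dir O e `<=` Pi ->
  major_axis_ends [set Q | Pi Q /\
      edist Q (O + (- c) *: e) + edist Q (O + c *: e) = 2 * a]
    (O + (- c) *: e) (O + c *: e) A P ->
  exists2 t, `|t| = a & A = O + t *: e /\ P = O + (- t) *: e.
Proof.
move=> e1 /andP[c0 ca] linePi [AP].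
have cN : - c != c by apply/eqP; lra.
rewrite line_through_on_axis //.
have sumE x : `|x| = a ->
    edist (O + x *: e) (O + (- c) *: e) + edist (O + x *: e) (O + c *: e) =
    2 * a.
  move=> xa; rewrite !edist_line // opprK.
  move: xa; case: (ger0P x); case: (ger0P (x + c)); case: (ger0P (x - c)); lra.
move=> endsE.
have ends x : `|x| = a -> O + x *: e = A \/ O + x *: e = P.
  move=> xa; suff : [set A; P] (O + x *: e) by [].
  rewrite -endsE; split; last by exists x.
  by split; [apply: linePi; exists x|exact: sumE].
have distinct : O + a *: e <> O + (- a) *: e.
  move=> aN; have : edist (O + a *: e) (O + (- a) *: e) = 0.
    by rewrite aN edist_line // subrr normr0.
  by rewrite edist_line // opprK ger0_norm; lra.
have aa : `|a| = a by rewrite ger0_norm; lra.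
have := ends _ aa; have := ends (- a); rewrite normrN => /(_ aa).
move=> [EA|EP] [EA'|EP'].
- by case: distinct; rewrite EA EA'.
- by exists (- a); rewrite ?normrN // opprK.
- by exists a.
- by case: distinct; rewrite EP EP'.
Qed.
End Frame.

(** * Position of the vertex of a cone through the ellipse *)

Section Vertex.
Variable R : realType.

Lemma cone_vertex_on_hyperbola (O e1 e2 e3 V : 'rV[R]_3) (C : set 'rV[R]_3)
    (a c : R) :
  dotv e1 e1 = 1 -> dotv e2 e2 = 1 -> dotv e3 e3 = 1 ->
  dotv e1 e2 = 0 -> dotv e1 e3 = 0 -> dotv e2 e3 = 0 ->
  0 < c < `|a| ->
  (forall x y,
    x ^+ 2 * (a ^+ 2 - c ^+ 2) + y ^+ 2 * a ^+ 2 = a ^+ 2 * (a ^+ 2 - c ^+ 2) ->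
    C (O + (x *: e1 + y *: e2))) ->
  is_cone_with_vertex C V ->
  dotv (V - O) e2 = 0 /\
  `|edist V (O + a *: e1) - edist V (O + (- a) *: e1)| = 2 * c.
Proof.
move=> e11 e22 e33 e12 e13 e23 /andP[c0 ca] EC [d [theta [d0 theta_bd CE]]].
have e21 : dotv e2 e1 = 0 by rewrite dotvC.
have parseval := dotv_parseval3 e11 e22 e33 e12 e13 e23.
have a0 : 0 < `|a| by lra.
have b0 : 0 < a ^+ 2 - c ^+ 2.
  by rewrite subr_gt0 -(real_normK (num_real a)) ltr_pXn2r // nnegrE ltW.
have bE : Num.sqrt (a ^+ 2 - c ^+ 2) ^+ 2 = `|a| ^+ 2 - c ^+ 2.
  by rewrite sqr_sqrtr ?ltW // real_normK ?num_real.
(* An aperture strictly below pi/2 keeps the factor k of the cone equation positive. *)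
have cos0 : 0 < cos theta.
  have /andP[t0 tpi] := theta_bd.
  by apply: cos_gt0_pihalf; rewrite tpi andbT; have := pi_gt0 R; lra.
have k0 : 0 < cos theta ^+ 2 * dotv d d.
  by rewrite mulr_gt0 ?exprn_gt0 // dotv_gt0.
have [W VE] : exists W, V = O + W by exists (V - O); rewrite addrC subrK.
have [v0 hyp] : dotv W e2 = 0 /\
    dotv W e1 ^+ 2 * Num.sqrt (a ^+ 2 - c ^+ 2) ^+ 2 =
    c ^+ 2 * (dotv W e3 ^+ 2 + Num.sqrt (a ^+ 2 - c ^+ 2) ^+ 2).
  (* Here al and be are the inner products of [d] with [e1] and [e2], and m that with [W]. *)
  apply: (@cone_vertex_coords R `|a| _ c _ (dotv e1 d) (dotv e2 d) (dotv W d)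
      _ _ _ c0 a0 _ bE k0); first by rewrite sqrtr_gt0.
  move=> x y; rewrite bE real_normK ?num_real // => /EC; rewrite CE.
  move=> /(cone_quadratic d0 theta_bd); rewrite VE subr_shift.
  rewrite [X in _ = _ * X]parseval !(dotvBl, dotvDl, dotvZl).
  rewrite e11 e22 e12 e21 e13 e23 => eq_cone.
  transitivity ((x * dotv e1 d + y * dotv e2 d - dotv W d) ^+ 2); first ring.
  rewrite eq_cone; ring.
split; first by rewrite VE addrAC subrr add0r.
rewrite bE real_normK ?num_real // in hyp.
set u := dotv W e1 in hyp; set w := dotv W e3 in hyp.
(* Treats both foci t = a and t = -a: once w^2 is eliminated, (u - t)^2 + w^2 is the square of tu/c
   - c. *)
have distE t : t ^+ 2 = a ^+ 2 ->
    edist V (O + t *: e1) = `|t * u / c - c|.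
  move=> ta; apply: edist_sqrt; rewrite VE subr_shift parseval.
  rewrite !(dotvBl, dotvZl) e11 e12 e13 v0 -/u -/w.
  have wE : w ^+ 2 = u ^+ 2 * (t ^+ 2 - c ^+ 2) / c ^+ 2 - (t ^+ 2 - c ^+ 2).
    rewrite ta hyp; field; exact: lt0r_neq0.
  transitivity ((u - t) ^+ 2 + w ^+ 2); first ring.
  rewrite wE; field; exact: lt0r_neq0.
rewrite !distE ?sqrrN // !mulNr -[- _ - c]opprD normrN dist_pm.
rewrite (gtr0_norm c0) min_r //.
(* Since w^2 >= 0, [hyp] forces |u| >= c; with |a| > c the minimum in [dist_pm] is thus c. *)
have cu : c <= `|u|.
  rewrite -(@ler_pXn2r _ 2) ?nnegrE ?(ltW c0) // real_normK ?num_real //.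
  rewrite -(ler_pM2r b0) hyp ler_pM2l ?exprn_gt0 //.
  by rewrite -[leLHS]add0r lerD2r sqr_ge0.
rewrite !normrM normfV (gtr0_norm c0) ler_pdivlMr //.
by apply: ler_pM => //; exact: ltW.
Qed.

End Vertex.

Theorem theorem2p2 (R : realType) (E Pi Pi' : set 'rV[R]_3)
    (F1 F2 A P : 'rV[R]_3)
    (hE : is_ellipse E Pi F1 F2)
    (hAP : major_axis_ends E F1 F2 A P)
    (hPi' : is_plane Pi')
    (hF : line_through F1 F2 `<=` Pi')
    (hperp : perpendicular_planes Pi Pi') :
  exists H : set 'rV[R]_3,
    is_hyperbola H Pi' A P F1 F2 /\
    forall (C : set 'rV[R]_3) (V : 'rV[R]_3),
      is_cone_with_vertex C V -> belongs_to_ellipse C E Pi -> H V.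
Proof.
case: hE => _ PiF1 PiF2 /eqP F12 [s [cs EE]].
case: hperp => p [n [p' [n' [n0 n'0 PiE Pi'E nn']]]].
rewrite eq_sym -subr_eq0 in F12.
set f := F2 - F1 in F12; have f0 : 0 < enorm f by rewrite enorm_gt0.
pose c := enorm f / 2; pose a := s / 2.
(* The normal of [Pi'] is orthogonal to both F1F2 and the normal of [Pi], so [e2] points along the
   minor axis. *)
pose e1 := (enorm f)^-1 *: f.
pose e2 := (enorm n')^-1 *: n'; pose e3 := (enorm n)^-1 *: n.
pose O := F1 + c *: e1.
have e11 : dotv e1 e1 = 1 by exact: dotv_normalize.
have e22 : dotv e2 e2 = 1 by exact: dotv_normalize.
have e33 : dotv e3 e3 = 1 by exact: dotv_normalize.
have F1E : F1 = O + (- c) *: e1 by rewrite scaleNr addrK.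
have F2E : F2 = O + c *: e1.
  rewrite /O -addrA -scalerDl /c -splitr scalerA divff ?gt_eqF //.
  by rewrite scale1r addrC subrK.
have Pi'on t : Pi' (F1 + t *: f) by apply: hF; exists t.
have planeF q m : plane_normal q m F1 -> plane_normal q m F2 -> dotv m f = 0.
  by rewrite /plane_normal /f /= !dotvBr => h1 h2; lra.
have Pi'F1 : Pi' F1 by apply: hF; exists 0; rewrite ?scale0r ?addr0.
have Pi'F2 : Pi' F2 by apply: hF; exists 1; rewrite ?scale1r // addrC subrK.
have nf : dotv n f = 0 by apply: (planeF p); rewrite -PiE.
have n'f : dotv n' f = 0 by apply: (planeF p'); rewrite -Pi'E.
have e12 : dotv e1 e2 = 0 by rewrite dotvZl dotvZr [dotv f _]dotvC n'f !mulr0.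
have e13 : dotv e1 e3 = 0 by rewrite dotvZl dotvZr [dotv f _]dotvC nf !mulr0.
have e23 : dotv e2 e3 = 0.
  by rewrite dotvZl dotvZr [dotv n' _]dotvC nn' !mulr0.
have axis_in q m : plane_normal q m F1 -> dotv m f = 0 ->
    line_dir O e1 `<=` plane_normal q m.
  move=> mF1 mf; have me1 : dotv m e1 = 0 by rewrite dotvZr mf mulr0.
  apply: line_in_plane => //; apply: (line_in_plane mF1 me1).
  by exists c.
have axisPi : line_dir O e1 `<=` Pi.
  by rewrite PiE; apply: axis_in => //; rewrite -PiE.
have axisPi' : line_dir O e1 `<=` Pi'.
  by rewrite Pi'E; apply: axis_in => //; rewrite -Pi'E.
have OPi : Pi O by apply: axisPi; exists 0; rewrite ?scale0r ?addr0.
have OPi' : Pi' O by apply: axisPi'; exists 0; rewrite ?scale0r ?addr0.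
clearbody O.
have c0 : 0 < c by rewrite divr_gt0.
have ca : c < a.
  rewrite ltr_pM2r ?invr_gt0 // (le_lt_trans _ cs) //.
  rewrite F1E F2E edist_line // -opprD normrN gtr0_norm ?addr_gt0 //.
  by rewrite /c -splitr.
have sE : s = 2 * a by rewrite /a; field.
have cab : 0 < c < a by rewrite c0.
rewrite EE sE F1E F2E in hAP.
have [t ta [AE PE]] := major_axis_on_axis e11 cab axisPi hAP.
have cat : 0 < c < `|t| by rewrite ta.
(* The witness is left open and read off from [hyperbola_on_axis]: the locus in [Pi'] with distance
   difference 2c. *)
rewrite {}AE {}PE F1E F2E; eexists; split.
  exact: hyperbola_on_axis.
move=> C V coneC belC.
have onC x y :
    x ^+ 2 * (t ^+ 2 - c ^+ 2) + y ^+ 2 * t ^+ 2 = t ^+ 2 * (t ^+ 2 - c ^+ 2) ->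
    C (O + (x *: e1 + y *: e2)).
  rewrite -(real_normK (num_real t)) ta => xy.
  suff : (C `&` Pi) (O + (x *: e1 + y *: e2)) by case.
  rewrite -belC EE sE F1E F2E; split.
    move: OPi; rewrite PiE /plane_normal /= => nO.
    by rewrite addrAC dotvDr nO add0r dotvDr !dotvZr nf nn' !mulr0 addr0.
  exact: ellipse_point.
have [V2 hyp] :=
  cone_vertex_on_hyperbola e11 e22 e33 e12 e13 e23 cat onC coneC.
split=> //.
(* As [e2] is the normalized normal of [Pi'], a zero [e2]-coordinate places V in that plane. *)
have n'VO : dotv n' (V - O) = 0.
  move/eqP: V2; rewrite dotvZr mulf_eq0 invr_eq0 gt_eqF ?enorm_gt0 //=.
  by rewrite dotvC => /eqP.
move: OPi'; rewrite Pi'E /plane_normal /= => OPi'.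
by rewrite -(subrK O V) -addrA dotvDr n'VO add0r.
Qed.
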